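(* Let $\alpha,k>0$, $r\in\mathbb{R}\setminus\{-1\}$, let $g:I\rightarrow\mathbb{R}$ be differentiable on $I^{\circ}$, and let $a,b\in I^{\circ}$ with $a<b$ and $g\in L_\infty[a,b]$. Let $q>1$ and $\frac1p+\frac1q=1$. If $|g'|^q$ is $\eta$-convex on $[a,b]$ with $\eta$ bounded on $|g'|^q([a,b])\times|g'|^q([a,b])$, then $$ \left|\frac{g(a)+g(b)}{2}-\frac{(r+1)^{\frac{\alpha}{k}}\Gamma_k(\alpha+k)}{4(b^{r+1}-a^{r+1})^{\frac{\alpha}{k}}}\left[{}_{k}^{r}\mathcal{J}_{a^+}^{\alpha}G(b)+{}_{k}^{r}\mathcal{J}_{b^-}^{\alpha}G(a)\right]\right| \leq \frac{b-a}{4(b^{r+1}-a^{r+1})^{\frac{\alpha}{k}}}\left(|g'(b)|^q+\frac{\eta(|g'(a)|^q,|g'(b)|^q)}{2}\right)^{\frac1q}\|\Theta_{\alpha,r}\|_p, $$ where $G(x)=g(x)+g(a+b-x)$ for $x\in[a,b]$, $\|\Theta_{\alpha,r}\|_p=\left(\int_0^1|\Theta_{\alpha,r}(t)|^p\,dt\right)^{1/p}$, and $\Theta_{\alpha,r}:[0,1]\to\mathbb{R}$ is $$\Theta_{\alpha,r}(t)=\left[(ta+(1-t)b)^{r+1}-a^{r+1}\right]^{\frac{\alpha}{k}}-\left[(tb+(1-t)a)^{r+1}-a^{r+1}\right]^{\frac{\alpha}{k}}+\left[b^{r+1}-(tb+(1-t)a)^{r+1}\right]^{\frac{\alpha}{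k}}-\left[b^{r+1}-(ta+(1-t)b)^{r+1}\right]^{\frac{\alpha}{k}}.$$
   Context: $I\subset\mathbb{R}$ is an interval and $I^\circ$ its interior. $\eta$-convexity: let $\eta$ be a real-valued function of two real variables (defined at least on the pairs of values of $h$ that occur). A function $h:J\to\mathbb{R}$ on an interval $J$ is $\eta$-convex if $h(\beta x+(1-\beta)y)\le h(y)+\beta\,\eta(h(x),h(y))$ for all $x,y\in J$ and $\beta\in[0,1]$. $k$-gamma function: $\Gamma_k(x)=\int_0^\infty t^{x-1}e^{-t^k/k}\,dt$ for $\mathrm{Re}(x)>0$, $k>0$; it satisfies $\Gamma_k(x+k)=x\Gamma_k(x)$ and $\Gamma_k(k)=1$. $(k,r)$-Riemann--Liouville fractional integrals of order $\alpha>0$ of a function $h$ on $[a,b]$, where $k>0$ and $r\in\mathbb{R}\setminus\{-1\}$: $${}_{k}^{r}\mathcal{J}_{a^+}^{\alpha}h(x)=\frac{(r+1)^{1-\frac{\alpha}{k}}}{k\Gamma_k(\alpha)}\int_a^x(x^{r+1}-t^{r+1})^{\frac{\alpha}{k}-1}t^r h(t)\,dt,\quad x>a,$$ $${}_{k}^{r}\mathcal{J}_{b^-}^{\alpha}h(x)=\frac{(r+1)^{1-\frac{\alpha}{k}}}{k\Gamma_k(\alpha)}\int_x^b(t^{r+1}-x^{r+1})^{\frac{\alpha}{k}-1}t^r h(t)\,dt,\quad x<b.$$ The assumption $g\in L_\infty[a,b]$ is made for the fractional integrals to be well defined.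
   Formalization: The power of b^{r+1}-a^{r+1} in the right-hand bound is taken in absolute value (for r=-2, α=k, 0<a<b the printed bound is negative), and a, b, r, α/k are restricted to cases where the real powers and integrals make sense and b^{r+1}≠a^{r+1}. *)

(* Defs.v *)
From HB Require Import structures.
From mathcomp Require Import all_boot all_order all_algebra.
From mathcomp Require Import all_classical all_reals all_analysis.

Set Implicit Arguments.
Unset Strict Implicit.
Unset Printing Implicit Defensive.

Import Order.TTheory GRing.Theory Num.Theory.
Import numFieldNormedType.Exports.

Local Open Scope classical_set_scope.
Local Open Scope ring_scope.

(* The real power x^s. It is the algebraic power when s is an integer
   (whatever the sign of x) and the usual x^s when 0 <= x. The remaining case
   x < 0, s not an integer, has no real value: rpow then returns |x|^s, the
   modulus of the principal complex value. For r < -1 and 0 < a < b this last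
   case is met with the negative bases r + 1 and x^(r+1) - t^(r+1), t < x; there
   the phases of (r+1)^(1-s) and (x^(r+1) - t^(r+1))^(s-1) cancel, as do those
   of (r+1)^s and (b^(r+1) - a^(r+1))^s, so that passing to moduli does not
   change these products. The library's powR is 1 on all negative bases, whence
   the explicit modulus. *)
Definition rpow (R : realType) (x s : R) : R :=
  if s \is a Num.int then x ^ Num.floor s else `|x| `^ s.

Lemma rpow_powR (R : realType) (x s : R) : 0 <= x -> rpow x s = x `^ s.
Proof.
move=> x0; rewrite /rpow; case: ifPn => [/intrP[z ->]|_]; last by rewrite ger0_norm.
by rewrite intrKfloor powR_intmul.
Qed.

(* Domain on which the formulas of the (k, r)-integrals on [a, b] make sense,
   where s = alpha / k:
   - t^r and t^(r+1) are real on [a, b] and t^r is integrable there;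
   - the outer powers, of exponents s and s - 1, are meaningful: either s is an
     integer, or t^r >= 0 on [a, b] so that x^(r+1) - t^(r+1), for t < x, has
     the sign of r + 1;
   - the denominator b^(r+1) - a^(r+1) does not vanish (which can only happen
     for a < 0 < b and r an odd integer).
   No restriction on alpha or k results when 0 <= a (see also the lemmas
   below), and then r is only constrained by r != -1, and by -1 < r if a = 0. *)
Definition admissible (R : realType) (a b r s : R) : Prop :=
  [/\ [\/ 0 < a,
          0 <= a /\ -1 < r
        | r \is a Num.int /\ (0 <= r \/ b < 0)],
      [\/ 0 <= a, s \is a Num.int | r / 2 \is a Num.int]
    & rpow b (r + 1) != rpow a (r + 1)].

Lemma admissible_gt0 (R : realType) (a b r s : R) :
  0 < a -> a < b -> r != -1 -> admissible a b r s.
Proof.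
move=> a0 ab r1; have b0 := lt_trans a0 ab.
split; [exact: Or31|exact/Or31/ltW|].
rewrite !rpow_powR ?ltW//; apply: contraNneq r1 => /(congr1 (@ln R)).
rewrite !ln_powR => /eqP; rewrite -subr_eq0 -mulrBr mulf_eq0 addr_eq0.
case/orP => //; rewrite subr_eq0 => /eqP /ln_inj E.
by move: ab; rewrite E ?ltxx// posrE.
Qed.

Lemma admissible_r0 (R : realType) (a b s : R) : a < b -> admissible a b 0 s.
Proof.
move=> ab; split.
- by apply: Or33; split; [exact: int_num0|left].
- by apply: Or33; rewrite mul0r int_num0.
- by rewrite add0r /rpow int_num1 floor1 !expr1z gt_eqF.
Qed.

Definition eta_convex (R : realType) (eta : R -> R -> R) (J : set R)
    (h : R -> R) : Prop :=
  forall x y beta, J x -> J y -> 0 <= beta <= 1 ->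
    h (beta * x + (1 - beta) * y) <= h y + beta * eta (h x) (h y).

Definition kgamma (R : realType) (k x : R) : R :=
  \int[lebesgue_measure]_(t in `]0, +oo[) (t `^ (x - 1) * expR (- (t `^ k / k))).

Definition krRL_left (R : realType) (k r alpha a : R) (h : R -> R) (x : R) : R :=
  rpow (r + 1) (1 - alpha / k) / (k * kgamma k alpha) *
  \int[lebesgue_measure]_(t in `[a, x])
    (rpow (rpow x (r + 1) - rpow t (r + 1)) (alpha / k - 1) * rpow t r * h t).

Definition krRL_right (R : realType) (k r alpha b : R) (h : R -> R) (x : R) : R :=
  rpow (r + 1) (1 - alpha / k) / (k * kgamma k alpha) *
  \int[lebesgue_measure]_(t in `[x, b])
    (rpow (rpow t (r + 1) - rpow x (r + 1)) (alpha / k - 1) * rpow t r * h t).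

Definition Theta (R : realType) (k r alpha a b t : R) : R :=
  let u := t * a + (1 - t) * b in
  let v := t * b + (1 - t) * a in
  rpow (rpow u (r + 1) - rpow a (r + 1)) (alpha / k)
  - rpow (rpow v (r + 1) - rpow a (r + 1)) (alpha / k)
  + rpow (rpow b (r + 1) - rpow v (r + 1)) (alpha / k)
  - rpow (rpow b (r + 1) - rpow u (r + 1)) (alpha / k).

Definition norm01 (R : realType) (p : R) (f : R -> R) : R :=
  (\int[lebesgue_measure]_(t in `[0, 1]) (`|f t| `^ p)) `^ p^-1.

Definition dpow (R : realType) (g : R -> R) (q x : R) : R := `|derive1 g x| `^ q.

Definition refl_sum (R : realType) (g : R -> R) (a b x : R) : R :=
  g x + g (a + b - x).

(* Main.v *)
(* Put W(x) = (phi(x) - phi(a))^s - (phi(b) - phi(x))^s with phi(x) = x^(r+1) and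
   s = alpha/k. Up to a constant the kernel of the sum of the two fractional
   integrals is W', so with u = ta + (1-t)b, v = a + b - u and C, D primitives of
   W' g and of x |-> W'(x) g(a + b - x), the function
     H(t) = (W(u) - W(v)) g(u) - C(u) + D(v)
   has derivative H'(t) = (a - b) Theta(t) g'(u), and H(1) - H(0) is the error
   multiplied by a constant. By eta-convexity |H'| is dominated by the continuous
   function (b - a) |Theta(t)| (|g'(b)|^q + t eta)^(1/q), so the mean value
   inequality followed by Hoelder's inequality concludes: g' itself is never
   integrated, and its measurability plays no role. *)
Require Import Defs.
From HB Require Import structures.
From mathcomp Require Import all_boot all_order all_algebra.
From mathcomp Require Import all_classical all_reals all_analysis.
From mathcomp Require Import measurable_realfun ring lra.

Set Implicit Arguments.
Unset Strict Implicit.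
Unset Printing Implicit Defensive.

Import Order.TTheory GRing.Theory Num.Theory.
Import numFieldNormedType.Exports.

Local Open Scope classical_set_scope.
Local Open Scope ring_scope.

(** The kernels may be unbounded near the ends of [[a, b]]: the outer exponent [s - 1] can be
    negative, and so can [r] when [a = 0]. Hence weights are continuous only on the open interval,
    while [W] is continuous up to the ends. Integrability is obtained without estimating any
    singularity: either the kernel is continuous on [[a, b]], or a constant multiple of it is
    nonnegative with a primitive continuous up to the ends, and monotone convergence concludes. [H]
    works because the reflection exchanges [u] and [v]: [C(u)] and [D(v)] both differentiate to
    multiples of [g(u)], which absorb the two terms where the derivative falls on [W]. The constant
    is [s (r + 1)] up to a sign, on both sides: it is the factor in the derivative of [W], and what
    the prefactors reduce to by [Γ_k(α + k) = α Γ_k(α)]. As [kgamma] is a bare Lebesgue integral,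
    its convergence, positivity and recurrence are proved here. The sign arises because [rpow] is
    even for a non-integer exponent. When [s] is not an integer, the bases keep the sign of [r + 1]
    on []a, b[], so that this sign is a constant. *)

(* The sign for which [s * rpow x (s - 1) * rsg s x] is the derivative of
   [rpow x s], which is even in [x] when [s] is not an integer. *)
Definition rsg (R : realType) (s x : R) : R :=
  if s \is a Num.int then 1 else Num.sg x.

(** * Algebra of real powers *)

Lemma rpowM (R : realType) (x y s : R) : rpow (x * y) s = rpow x s * rpow y s.
Proof.
by rewrite /rpow; case: ifP => _; [exact: expfzMl|rewrite normrM powRM].
Qed.

Lemma normr_rpow (R : realType) (x s : R) : `|rpow x s| = `|x| `^ s.
Proof.
rewrite /rpow; case: ifPn => [/intrP[z ->]|_]; last by rewrite ger0_norm ?powR_ge0.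
rewrite intrKfloor powR_intmul//.
by case: z => n; rewrite ?NegzE -?exprnN -?exprnP ?normfV normrX.
Qed.

Lemma rpow_neq0 (R : realType) (x s : R) : x != 0 -> rpow x s != 0.
Proof. by move=> x0; rewrite -normr_eq0 normr_rpow powR_eq0 normr_eq0 (negbTE x0). Qed.

Lemma rpow0 (R : realType) (s : R) : 0 < s -> rpow 0 s = 0.
Proof. by move=> s0; rewrite rpow_powR// powR0// gt_eqF. Qed.

Lemma rpow_ge0 (R : realType) (x s : R) : 0 <= x -> 0 <= rpow x s.
Proof. by move=> x0; rewrite rpow_powR// powR_ge0. Qed.

Lemma rpow_natr (R : realType) (x : R) (n : nat) : rpow x n%:R = x ^+ n.
Proof. by rewrite /rpow -[n%:R]/((n : int)%:~R) intr_int intrKfloor. Qed.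

Lemma rsgM (R : realType) (s x y : R) : rsg s (x * y) = rsg s x * rsg s y.
Proof. by rewrite /rsg; case: ifP => _; rewrite ?mul1r// sgrM. Qed.

Lemma rsg_gt0 (R : realType) (s x : R) : 0 < x -> rsg s x = 1.
Proof. by rewrite /rsg; case: ifP => // _ /gtr0_sg. Qed.

Lemma rpowB1 (R : realType) (s x : R) : x != 0 ->
  rpow x s = rpow x (s - 1) * (rsg s x * x).
Proof.
move=> x0; have sE : (s - 1 \is a Num.int) = (s \is a Num.int).
  by rewrite rpredBr// int_num1.
rewrite /rsg /rpow sE; case: ifPn => [sZ|_].
  move: sZ => /intrP[z ->]; rewrite mul1r -(intrB _ z 1) !intrKfloor.
  by rewrite -{3}(expr1z x) -expfzDr// subrK.
rewrite -normrEsg powRB ?normr_eq0 ?x0 ?implybT//.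
by rewrite powRr1// divfK// normr_eq0.
Qed.

(** Combines the power [s] of [r + 1] in the theorem with the power [1 - s] in front of each
    fractional integral; this is where [rsg] enters the constant. *)
Lemma rpow_mul_conj (R : realType) (s x : R) : x != 0 ->
  rpow x s * rpow x (1 - s) = rsg s x * x.
Proof.
move=> x0; have sE : (1 - s \is a Num.int) = (s \is a Num.int).
  by rewrite rpredBl// int_num1.
rewrite /rsg /rpow sE; case: ifPn => [sZ|_].
  move: sZ => /intrP[z ->]; rewrite mul1r -(intrB _ 1 z) !intrKfloor -expfzDr//.
  by rewrite addrC subrK expr1z.
rewrite -normrEsg -powRD ?normr_eq0 ?x0 ?implybT//.
by rewrite addrC subrK powRr1.
Qed.

(** * Differentiability and continuity of real powers *)

Lemma is_derive_rpow (R : realType) (s x : R) :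
  x != 0 \/ (s \is a Num.int /\ 0 < s) ->
  is_derive x 1 (@rpow R ^~ s) (s * rpow x (s - 1) * rsg s x).
Proof.
have [->|x0 _] := eqVneq x 0.
  case=> // -[sZ s0]; have /natrP[[|n] sE] : s \is a Num.nat by rewrite -intrEge0// ltW.
    by rewrite sE ltxx in s0.
  have -> : @rpow R ^~ s = (fun y : R => y ^+ n.+1) by apply/funext => y; rewrite sE rpow_natr.
  rewrite /rsg sZ mulr1 (_ : s - 1 = n%:R); last by rewrite sE -natr1 addrK.
  rewrite rpow_natr sE.
  apply: DeriveDef; first exact: exprn_derivable.
  by rewrite exp_derive /GRing.scale/= mulr1.
have [xlt|xgt|xe] := ltgtP x 0; last by rewrite xe eqxx in x0.
(* For [x < 0], writing [x = -1 * - x] turns the power into the constant [rpow (-1) s] times a power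
   of a positive base. *)
- have -> : s * rpow x (s - 1) * rsg s x = rpow (-1) s * ((s * (- x) `^ (s - 1)) * -1).
    have N0 : - x > 0 by rewrite oppr_gt0.
    have {1}-> : x = -1 * - x by rewrite mulrNN mul1r.
    have {2}-> : x = -1 * - x by rewrite mulrNN mul1r.
    rewrite rpowM rsgM (rsg_gt0 _ N0) (rpow_powR _ (ltW N0)).
    rewrite (@rpowB1 _ s (-1)) ?oppr_eq0 ?oner_eq0//; ring.
  apply: (@near_eq_is_derive _ _ _ (fun y => rpow (-1) s * ((- y) `^ s))).
    near=> y; have y0 : y < 0 by near: y; exact: lt_nbhsl.
    by rewrite -rpow_powR ?oppr_ge0 ?ltW// -rpowM mulrNN mul1r.
  have D : is_derive x 1 (fun y : R => (- y) `^ s) (s * (- x) `^ (s - 1) * -1).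
    apply: (@is_derive1_comp _ (@powR R ^~ s) -%R).
    by apply: is_derive1_powR; rewrite oppr_gt0.
  by apply: is_derive_eq.
- rewrite rsg_gt0// mulr1 rpow_powR; last exact: ltW.
  apply: (@near_eq_is_derive _ _ _ (@powR R ^~ s)); last exact: is_derive1_powR.
  by near=> y; rewrite rpow_powR//; near: y; apply: filterS (lt_nbhsr xgt) => y /ltW.
Unshelve. all: by end_near. Qed.

Lemma is_derive_continuous (R : realType) (f : R -> R) (x d : R) :
  is_derive x 1 f d -> {for x, continuous f}.
Proof. by move=> [/derivable1_diffP/differentiable_continuous]. Qed.

Lemma continuous_rpow (R : realType) (s x : R) :
  x != 0 \/ 0 < s -> {for x, continuous (@rpow R ^~ s)}.
Proof.
have [->|x0 _] := eqVneq x 0; last exact: is_derive_continuous (is_derive_rpow (or_introl x0)).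
case=> // s0; rewrite /prop_for /continuous_at rpow0//.
apply/cvgr0Pnorm_lt => e e0; near=> y.
rewrite normr_rpow; have -> : e = (e `^ s^-1) `^ s.
  by rewrite -powRrM mulVf ?gt_eqF// powRr1// ltW.
apply: gt0_ltr_powR => //; rewrite ?nnegrE ?powR_ge0//.
near: y; exists (e `^ s^-1); first exact: powR_gt0.
by move=> y /=; rewrite sub0r normrN.
Unshelve. all: by end_near. Qed.

(** Includes the exponent 0 at the base 0, where the power is constantly 1; it is met with [r = 0]
    and with [s - 1 = 0]. *)
Lemma continuous_rpow_natr (R : realType) (s x : R) :
  s \is a Num.nat -> {for x, continuous (@rpow R ^~ s)}.
Proof.
move=> /natrP[n ->]; have -> : @rpow R ^~ n%:R = (fun y : R => y ^+ n).
  by apply/funext => y; rewrite rpow_natr.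
exact: exprn_continuous.
Qed.

(** * Integration: fundamental theorem, exhaustion by segments, primitives *)

Lemma continuous_on_cc (R : realType) (f : R -> R) (a b : R) :
  (forall x, a <= x <= b -> {for x, continuous f}) ->
  {within `[a, b], continuous f}.
Proof.
by move=> cf; apply: continuous_in_subspaceT => x; rewrite inE/= in_itv/=; exact: cf.
Qed.

Lemma integrable_continuous_cc (R : realType) (f : R -> R) (a b : R) :
  (forall x, a <= x <= b -> {for x, continuous f}) ->
  lebesgue_measure.-integrable `[a, b] (EFin \o f).
Proof.
move=> cf; apply: continuous_compact_integrable; first exact: segment_compact.
exact: continuous_on_cc.
Qed.

Lemma integral_is_derive (R : realType) (f F : R -> R) (a b : R) : a <= b ->
  (forall x, a <= x <= b -> {for x, continuous f}) ->
  (forall x, a <= x <= b -> is_derive x 1 F (f x)) ->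
  (\int[lebesgue_measure]_(x in `[a, b]) (f x)%:E = (F b - F a)%:E)%E.
Proof.
rewrite le_eqVlt => /predU1P[->|ab] cf dF.
  by rewrite set_itv1 integral_set1 subrr.
have cF x : a <= x <= b -> {for x, continuous F} by move=> /dF /is_derive_continuous.
rewrite (@continuous_FTC2 _ f F a b ab (continuous_on_cc cf)) ?EFinB//.
  split.
  - move=> x; rewrite in_itv/= => /andP[/ltW ax /ltW xb].
    by have [] := dF x _; rewrite ?ax ?xb.
  - by apply: cvg_at_right_filter; apply: cF; rewrite lexx ltW.
  - by apply: cvg_at_left_filter; apply: cF; rewrite lexx ltW.
move=> x; rewrite in_itv/= => /andP[/ltW ax /ltW xb]; rewrite derive1E.
by have [] := dF x _; rewrite ?ax ?xb.
Qed.

(** Treats improper integrals on []a, b[] and on []0, +oo[] alike: on each segment the integrand is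
    continuous and the fundamental theorem applies. *)
Definition exhaustion (R : realType) (c d : R^nat) (D : set R) : Prop :=
  [/\ {homo c : m n / (m <= n)%N >-> n <= m},
      {homo d : m n / (m <= n)%N >-> m <= n},
      forall n, c n <= d n,
      D = \bigcup_n `[c n, d n]%classic
    & open D].

Lemma exhaustionS (R : realType) (c d : R^nat) (D : set R) n x :
  exhaustion c d D -> c n <= x <= d n -> D x.
Proof. by move=> [_ _ _ -> _] h; exists n => //=; rewrite in_itv. Qed.

Lemma measurable_fun_continuous_on (R : realType) (D : set R) (f : R -> R) :
  open D -> (forall x, D x -> {for x, continuous f}) -> measurable_fun D f.
Proof.
move=> oD cf; apply: open_continuous_measurable_fun => // x.
by rewrite inE; exact: cf.
Qed.

Lemma ge0_integral_exhaustion (R : realType) (c d : R^nat) (D : set R) (f : R -> R) :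
  exhaustion c d D ->
  (forall x, D x -> {for x, continuous f}) -> (forall x, D x -> 0 <= f x) ->
  (\int[lebesgue_measure]_(x in `[c n, d n]) (f x)%:E @[n --> \oo] -->
    \int[lebesgue_measure]_(x in D) (f x)%:E)%E.
Proof.
move=> ex cf f0; have [cN dN _ DE oD] := ex; rewrite [in X in _ --> X]DE.
have := @ge0_nondecreasing_set_cvg_integral _ (measurableTypeR R) R (fun n => `[c n, d n]%classic)
  (EFin \o f) (@lebesgue_measure R).
apply => //.
- move=> m n mn; apply/subsetPset/subset_itvScc; rewrite bnd_simp.
    exact: cN.
  exact: dN.
- move=> n; apply/measurable_EFinP.
  apply: measurable_funS (measurable_fun_continuous_on oD cf); first exact: open_measurable.
  by move=> x; rewrite /= in_itv/=; exact: exhaustionS ex.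
- by move=> n x; rewrite /= in_itv/= lee_fin => /(exhaustionS ex); exact: f0.
Qed.

(** On each segment the integral is an increment of [F], hence at most [M]; the bound passes to the
    limit by monotone convergence. *)
Lemma ge0_integrable_exhaustion (R : realType) (c d : R^nat) (D : set R)
    (f F : R -> R) (M : R) :
  exhaustion c d D ->
  (forall x, D x -> {for x, continuous f}) -> (forall x, D x -> 0 <= f x) ->
  (forall x, D x -> is_derive x 1 F (f x)) ->
  (forall n, F (d n) - F (c n) <= M) ->
  lebesgue_measure.-integrable D (EFin \o f).
Proof.
move=> ex cf f0 dF FM; have [_ _ cd _ oD] := ex; apply/integrableP; split.
  by apply/measurable_EFinP; exact: measurable_fun_continuous_on.
have -> : (\int[lebesgue_measure]_(x in D) `|(EFin \o f) x| =
    \int[lebesgue_measure]_(x in D) (f x)%:E)%E.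
  by apply: eq_integral => x; rewrite inE => /f0 fx0 /=; rewrite ger0_norm.
apply: (@le_lt_trans _ _ M%:E); last exact: ltry.
have cvi := ge0_integral_exhaustion ex cf f0.
rewrite -(cvg_lim _ cvi)//; apply: lime_le; first by apply/cvg_ex; eexists; exact: cvi.
apply: nearW => n.
have cfn x : c n <= x <= d n -> {for x, continuous f} by move=> /(exhaustionS ex)/cf.
have dFn x : c n <= x <= d n -> is_derive x 1 F (f x) by move=> /(exhaustionS ex)/dF.
by rewrite (integral_is_derive (cd n) cfn dFn) lee_fin.
Qed.

Lemma integrable_oo_cc (R : realType) (f : R -> R) (a b : R) :
  lebesgue_measure.-integrable `]a, b[ (EFin \o f) ->
  lebesgue_measure.-integrable `[a, b] (EFin \o f).
Proof.
move=> /integrableP[mf fy]; apply/integrableP; split.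
  exact: emeasurable_fun_itv_cc mf.
by rewrite integral_itv_bndoo//; exact: measurableT_comp.
Qed.

(** [F] is nondecreasing because its derivative is nonnegative, so its increments over inner
    segments are at most [F b - F a], however [f] behaves at the ends. *)
Lemma ge0_integrable_is_derive (R : realType) (f F : R -> R) (a b : R) : a < b ->
  (forall x, a <= x <= b -> {for x, continuous F}) ->
  (forall x, a < x < b -> {for x, continuous f}) ->
  (forall x, a < x < b -> 0 <= f x) ->
  (forall x, a < x < b -> is_derive x 1 F (f x)) ->
  lebesgue_measure.-integrable `[a, b] (EFin \o f).
Proof.
move=> ab cF cf f0 dF; apply: integrable_oo_cc.
(* The shift by 2 keeps [a + e n <= b - e n]; for [n = 0] the segment is the midpoint. *)
pose e n := (b - a) / n.+2%:R.
have e_gt0 n : 0 < e n by rewrite divr_gt0// subr_gt0.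
have e_le n : 2 * e n <= b - a.
  have n2 : (2 : R) / n.+2%:R <= 1 by rewrite ler_pdivrMr// mul1r ler_nat.
  by rewrite /e mulrCA ler_piMr// subr_ge0 ltW.
have e_nincr : {homo e : m n / (m <= n)%N >-> n <= m}.
  move=> m n mn; apply: ler_wpM2l; first by rewrite subr_ge0 ltW.
  by rewrite lef_pV2 ?posrE// ler_nat !ltnS.
have dF' x : `]a, b[%classic x -> is_derive x 1 F (f x).
  by rewrite /= in_itv/=; exact: dF.
apply: (@ge0_integrable_exhaustion _ (fun n => a + e n) (fun n => b - e n) _
  f F (F b - F a) _ _ _ dF'); first split.
- by move=> m n /e_nincr; rewrite lerD2l.
- by move=> m n /e_nincr; rewrite lerD2l lerN2.
- by move=> n; have := e_le n; lra.
- apply/seteqP; split => x /=.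
    rewrite in_itv/= => /andP[ax xb].
    pose m := Num.min (x - a) (b - x).
    have m0 : 0 < m by rewrite lt_min !subr_gt0 ax xb.
    have [n nP] : exists n : nat, (b - a) / m < n%:R.
      exists (Num.bound ((b - a) / m)).
      by apply: archi_boundP; apply/ltW/divr_gt0; rewrite ?subr_gt0.
    exists n => //=; rewrite in_itv/=.
    have : e n <= m.
      rewrite /e ler_pdivrMr// mulrC -ler_pdivrMr// (le_trans (ltW nP))// ler_nat.
      by rewrite -addn2 leq_addr.
    by rewrite /m le_min => /andP[]; lra.
  move=> [n _] /=; rewrite !in_itv/= => /andP[].
  by have := e_gt0 n; lra.
- exact: interval_open.
- by move=> x; rewrite /= in_itv/=; exact: cf.
- by move=> x; rewrite /= in_itv/=; exact: f0.
- move=> n; have en := e_gt0 n; have en2 := e_le n.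
  have mono : {in `[a, b] &, {homo F : x y / x <= y >-> x <= y}}.
    apply: ger0_derive1_le_cc; last exact: continuous_on_cc.
    - by move=> x; rewrite in_itv/= => /dF[].
    - by move=> x; rewrite in_itv/= => xab; rewrite derive1E; have [_ ->] := dF _ xab; exact: f0.
  by apply: lerB; apply: mono; rewrite ?in_itv/=; lra.
Qed.

(** The primitive is continuous from both sides even at [a] and [b], so that it can be composed with
    affine maps of [[0, 1]] at the end points. *)
Lemma exists_primitive (R : realType) (f : R -> R) (a b : R) : a < b ->
  lebesgue_measure.-integrable `[a, b] (EFin \o f) ->
  exists C : R -> R,
  [/\ forall x, a <= x <= b -> {for x, continuous C},
      forall x, a < x < b -> {for x, continuous f} -> is_derive x 1 C (f x)
    & C b - C a = \int[lebesgue_measure]_(x in `[a, b]) f x].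
Proof.
(* Extension by zero to [[a - 1, b + 1]] makes [a] and [b] interior points, where the integral with
   variable upper bound is continuous from both sides. *)
move=> ab intf; pose h := f \_ `[a, b].
have inth : lebesgue_measure.-integrable `[a - 1, b + 1] (EFin \o h).
  rewrite -restrict_EFin; apply/integrable_restrict => //=.
  by rewrite setIidr//; apply: subset_itvScc; rewrite bnd_simp; lra.
have hP x y : a <= x -> y <= b ->
    \int[lebesgue_measure]_(t in `[x, y]) h t = \int[lebesgue_measure]_(t in `[x, y]) f t.
  move=> ax yb; apply: eq_Rintegral => t; rewrite inE/= in_itv/= => /andP[xt ty].
  by rewrite /h patchE mem_set//= in_itv/=; apply/andP; split; lra.
have ab1 : a - 1 < b + 1 by lra.
pose C := fun x => parameterized_integral lebesgue_measure (a - 1) x h.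
exists C; split.
- move=> x /andP[ax xb].
  have := parameterized_integral_continuous (ltW ab1) inth.
  move=> /(continuous_within_itvP _ ab1)[+ _ _]; apply.
  by rewrite in_itv/=; apply/andP; split; lra.
- move=> x /andP[ax xb] cfx.
  have hE : \forall y \near x, h y = f y.
    near=> y; rewrite /h patchE mem_set//= in_itv/=; apply/andP; split; apply/ltW.
      by near: y; exact: lt_nbhsr.
    by near: y; exact: lt_nbhsl.
  have chx : {for x, continuous h}.
    rewrite /prop_for /continuous_at.
    have -> : h x = f x by exact: (nbhs_singleton hE).
    by apply: cvg_trans cfx; apply: near_eq_cvg; apply: filterS hE => y ->.
  have xb1 : x < b + 1 by lra.
  have ax1 : a - 1 < x by lra.
  have [D1 D2] := continuous_FTC1_closed xb1 inth ax1 chx.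
  apply: DeriveDef; first exact: D1.
  by rewrite -derive1E D2; exact: (nbhs_singleton hE).
- rewrite /C /parameterized_integral -(hP a b)// Rintegral_itvB ?bnd_simp; try lra.
    rewrite Rintegral_itv_obnd_cbnd//.
    by apply: integrableS inth => //; move=> x /=; rewrite !in_itv/= => /andP[? ?];
    apply/andP; split; lra.
  by apply: integrableS inth => //; move=> x /=; rewrite !in_itv/= => /andP[? ?];
    apply/andP; split; lra.
Unshelve. all: by end_near. Qed.

(** * The k-gamma function: convergence, positivity, recurrence *)

Definition kgamma_fun (R : realType) (k x t : R) : R :=
  t `^ (x - 1) * expR (- (t `^ k / k)).

(** The inequality [1 + z <= expR z] at [z = y / (n + 1)], raised to the power [n + 1]. *)
Lemma pow_expRN_le (R : realType) (n : nat) (y : R) :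
  0 <= y -> y ^+ n.+1 * expR (- y) <= n.+1%:R ^+ n.+1.
Proof.
move=> y0; rewrite expRN ler_pdivrMr ?expR_gt0//.
have -> : expR y = expR (y / n.+1%:R) ^+ n.+1.
  by rewrite -expRM_natl mulrCA divff ?mulr1// pnatr_eq0.
rewrite -exprMn lerXn2r ?nnegrE ?mulr_ge0 ?expR_ge0//.
rewrite mulrC -ler_pdivrMr ?ltr0n//.
by apply: le_trans (expR_ge1Dx _); rewrite lerDr.
Qed.

(** With [y = t^k / k], the power [t^x = (k y)^(x / k)] is at most [1 + (k y)^n] for a natural
    [n >= x / k], which reduces the bound to integer powers of [y]. It gives both the majorant of
    the gamma integrand and the decay of the boundary term at infinity. *)
Lemma powR_expRN_bounded (R : realType) (k x : R) : 0 < k -> 0 < x ->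
  exists2 K, 0 < K & forall t, 0 < t -> (1 + t `^ x) ^+ 2 * expR (- (t `^ k / k)) <= K.
Proof.
move=> k0 x0; pose n := (Num.bound (x / k)).+1.
have nP : x / k <= n%:R.
  rewrite /n -natr1 ler_wpDr//; apply/ltW/archi_boundP/ltW; exact: divr_gt0.
have [N NE] : exists N, (2 * n)%N = N.+1 by exists (2 * n).-1%N; rewrite /n mulnS.
(* From [(2 + z)^2 <= 8 + 2 z^2] with [z = (k y)^n], where [z^2] has the exponent [2 n = N + 1]. *)
exists (8 + 2 * (k ^+ N.+1 * N.+1%:R ^+ N.+1)).
  by rewrite ltr_pwDl// !mulr_ge0// exprn_ge0// ltW.
move=> t t0; set y := t `^ k / k.
have y0 : 0 <= y by rewrite divr_ge0 ?powR_ge0// ltW.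
have tk : t `^ k = k * y by rewrite /y mulrC divfK// gt_eqF.
have tx : t `^ x <= 1 + (k * y) ^+ n.
  have -> : t `^ x = (k * y) `^ (x / k).
    by rewrite -tk -powRrM mulrC divfK// gt_eqF.
  have [ky1|ky1] := leP (k * y) 1.
    apply: (@le_trans _ _ 1); last by rewrite lerDl exprn_ge0// mulr_ge0// ltW.
    have one : (1 : R) `^ (x / k) = 1 by rewrite powR1.
    rewrite -[leRHS]one; apply: ge0_ler_powR; rewrite ?nnegrE//.
      by rewrite divr_ge0// ltW.
    by rewrite mulr_ge0// ltW.
  apply: (@le_trans _ _ ((k * y) `^ n%:R)); first exact: ler_powR (ltW ky1) _ _ nP.
  by rewrite powR_mulrn ?lerDr// mulr_ge0// ltW.
have sq : (1 + t `^ x) ^+ 2 <= 8 + 2 * (k ^+ N.+1 * y ^+ N.+1).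
  rewrite -exprMn -NE mulnC exprM; set z := (k * y) ^+ n in tx *.
  have z0 : 0 <= z by rewrite exprn_ge0// mulr_ge0// ltW.
  have := powR_ge0 t x; set w := t `^ x in tx *; move=> w0.
  apply: (@le_trans _ _ ((2 + z) ^+ 2)); first by rewrite lerXn2r ?nnegrE; lra.
  have := sqr_ge0 (2 - z); lra.
have e0 := expR_ge0 (- y).
apply: (le_trans (ler_wpM2r e0 sq)).
rewrite mulrDl lerD//; first by rewrite ler_piMr// -expR0 ler_expR oppr_le0.
rewrite -!mulrA ler_pM2l// ler_wpM2l ?exprn_ge0//; first exact: ltW.
exact: pow_expRN_le.
Qed.

(** The integration by parts behind the recurrence, in differential form: the two terms are the
    integrands of [x Γ_k(x)] and [Γ_k(x + k)]. *)
Lemma is_derive_kgamma_fun (R : realType) (k x t : R) : 0 < k -> 0 < t ->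
  is_derive t 1 (kgamma_fun k (x + 1)) (x * kgamma_fun k x t - kgamma_fun k (x + k) t).
Proof.
move=> k0 t0; rewrite /kgamma_fun addrK.
have D1 : is_derive t 1 (@powR R ^~ x) (x * t `^ (x - 1)) by exact: is_derive1_powR.
have D2 : is_derive t 1 (@powR R ^~ k) (k * t `^ (k - 1)) by exact: is_derive1_powR.
have D3 : is_derive t 1 (fun t => - (t `^ k / k)) (- t `^ (k - 1)).
  apply: is_derive_eq.
  by rewrite /GRing.scale/=; field; rewrite gt_eqF.
have D4 : is_derive t 1 (fun t => expR (- (t `^ k / k)))
    (expR (- (t `^ k / k)) * - t `^ (k - 1)).
  exact: (@is_derive1_comp _ expR (fun t => - (t `^ k / k))).
have D5 := is_deriveM D1 D4.
apply: (is_derive_eq D5).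
rewrite /GRing.scale/= (_ : x + k - 1 = x + (k - 1)); last by rewrite addrA.
by rewrite (@powRD _ t x (k - 1)) ?(gt_eqF t0) ?implybT//; ring.
Qed.

Lemma continuous_kgamma_fun (R : realType) (k x t : R) : 0 < k -> 0 < t ->
  {for t, continuous (kgamma_fun k x)}.
Proof.
move=> k0 t0; apply: is_derive_continuous.
by rewrite -{1}(subrK 1 x); exact: is_derive_kgamma_fun.
Qed.

Lemma exhaustion_gt0 (R : realType) :
  exhaustion (fun n => n.+1%:R^-1) (fun n => n.+1%:R) (`]0, +oo[%classic : set R).
Proof.
split.
- by move=> m n mn; rewrite lef_pV2 ?posrE// ler_nat.
- by move=> m n mn; rewrite ler_nat.
- by move=> n; apply: (@le_trans _ _ 1); rewrite ?invf_le1// ler1n.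
- apply/seteqP; split => x /=; rewrite in_itv/= ?andbT.
    move=> x0; exists (maxn (Num.bound x^-1) (Num.bound x)) => //=; rewrite in_itv/=.
    have x1 : x^-1 < (Num.bound x^-1)%:R by apply/archi_boundP/ltW; rewrite invr_gt0.
    have x2 : x < (Num.bound x)%:R by exact/archi_boundP/ltW.
    apply/andP; split.
      rewrite -[leRHS]invrK lef_pV2 ?posrE ?invr_gt0//.
      by apply: (le_trans (ltW x1)); rewrite ler_nat leqW// leq_maxl.
    by apply: (le_trans (ltW x2)); rewrite ler_nat leqW// leq_maxr.
  move=> [n _] /=; rewrite in_itv/= => /andP[+ _].
  by apply: lt_le_trans; rewrite invr_gt0.
- exact: interval_open.
Qed.

(** A single majorant serves both ends: [t^(x-1) / (1 + t^x)^2] behaves like [t^(x-1)] at 0 and like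
    [t^(-x-1)] at infinity, and has an explicit primitive. *)
Lemma integrable_kgamma_fun (R : realType) (k x : R) : 0 < k -> 0 < x ->
  lebesgue_measure.-integrable `]0, +oo[ (EFin \o kgamma_fun k x).
Proof.
move=> k0 x0; have [K K0 KP] := powR_expRN_bounded k0 x0.
(* [m] has the bounded primitive [U]. *)
pose m (t : R) := t `^ (x - 1) / (1 + t `^ x) ^+ 2.
pose U (t : R) := - (x * (1 + t `^ x))^-1.
have p0 (t : R) : 0 < 1 + t `^ x by rewrite ltr_pwDl// powR_ge0.
have dU (t : R) : `]0, +oo[%classic t -> is_derive t 1 U (m t).
  rewrite /= in_itv/= andbT => t0.
  have D1 : is_derive t 1 (@powR R ^~ x) (x * t `^ (x - 1)) by exact: is_derive1_powR.
  have D2 : is_derive t 1 (fun t : R => x * (1 + t `^ x)) (x * (x * t `^ (x - 1))).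
    apply: is_derive_eq.
    by rewrite /GRing.scale/=; ring.
  have n0 : x * (1 + t `^ x) != 0 by rewrite mulf_neq0 ?gt_eqF.
  have D3 := is_deriveN (@is_deriveV _ (fun t : R => x * (1 + t `^ x)) t _ 1 n0 D2).
  apply: (is_derive_eq D3).
  by rewrite /GRing.scale/= /m; field; rewrite !gt_eqF.
have cm (t : R) : `]0, +oo[%classic t -> {for t, continuous m}.
  rewrite /= in_itv/= andbT => t0.
  apply: continuousM; first exact: (is_derive_continuous (is_derive1_powR _ t0)).
  apply: continuousV; first by rewrite expf_neq0// gt_eqF.
  apply: (@continuous_comp _ _ _ (fun t => 1 + t `^ x) (fun y => y ^+ 2));
    last exact: exprn_continuous.
  apply: continuousD; first exact: cst_continuous.
  exact: (is_derive_continuous (is_derive1_powR _ t0)).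
have m0 (t : R) : 0 <= m t by rewrite divr_ge0 ?powR_ge0// sqr_ge0.
have mi : lebesgue_measure.-integrable `]0, +oo[ (EFin \o m).
  apply: (@ge0_integrable_exhaustion _ _ _ _ m U x^-1 (exhaustion_gt0 R) cm _ dU) => // n.
  have U0 (t : R) : U t <= 0 by rewrite oppr_le0 invr_ge0 mulr_ge0 ?ltW.
  have U1 (t : R) : - U t <= x^-1.
    by rewrite opprK lef_pV2 ?posrE ?mulr_gt0// ler_peMr ?lerDl ?powR_ge0// ltW.
  by have := U0 n.+1%:R; have := U1 n.+1%:R^-1; lra.
have Ki : lebesgue_measure.-integrable `]0, +oo[ (fun t => K%:E * (EFin \o m) t)%E.
  exact: integrableZl.
apply: (le_integrable _ _ _ Ki) => //.
  apply/measurable_EFinP; apply: measurable_fun_continuous_on; first exact: interval_open.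
  by move=> t; rewrite /= in_itv/= andbT; exact: continuous_kgamma_fun.
move=> t; rewrite /= in_itv/= andbT => t0; rewrite lee_fin.
rewrite !ger0_norm ?mulr_ge0 ?powR_ge0 ?expR_ge0 ?invr_ge0 ?sqr_ge0 ?(ltW K0)//.
rewrite /kgamma_fun /m mulrCA ler_wpM2l ?powR_ge0//.
by rewrite ler_pdivlMr ?exprn_gt0// mulrC KP.
Qed.

Lemma kgamma_gt0 (R : realType) (k x : R) : 0 < k -> 0 < x -> 0 < kgamma k x.
Proof.
move=> k0 x0; have fi := integrable_kgamma_fun k0 x0.
(* A lower bound of the integrand on [[1, 2]], an interval of length 1: there
   [t^(x-1) >= 1/t >= 1/2], and the exponential is least at 2. *)
pose e : R := 2^-1 * expR (- (2 `^ k / k)).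
have e0 : 0 < e by rewrite mulr_gt0// expR_gt0.
apply: (lt_le_trans e0).
have s12 : `[1, 2]%classic `<=` (`]0, +oo[%classic : set R).
  by move=> t /=; rewrite !in_itv/= andbT => /andP[t1 _]; lra.
have -> : e = \int[lebesgue_measure]_(t in `[1, 2]%classic) cst e t.
  rewrite Rintegral_cst//= (@lebesgue_measure_itv R `[1, 2]%R)/= lte_fin ltr1n/=.
  by ring.
apply: (@le_trans _ _ (\int[lebesgue_measure]_(t in `[1, 2]%classic) kgamma_fun k x t)).
  apply: le_Rintegral.
  - exact: measurable_itv.
  - by apply: integrable_continuous_cc => t _; exact: cst_continuous.
  - exact: integrableS fi.
  - move=> t /=; rewrite in_itv/= => /andP[t1 t2].
    have t0 : 0 < t by lra.
    apply: ler_pM; rewrite ?invr_ge0 ?expR_ge0//.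
      rewrite powRB ?(gt_eqF t0) ?implybT// powRr1; last exact: ltW.
      apply: (@le_trans _ _ t^-1); first by rewrite lef_pV2 ?posrE.
      rewrite ler_peMl ?invr_ge0 ?(ltW t0)//.
      by rewrite -(powRr0 t) ler_powR// ltW.
    rewrite ler_expR lerN2 ler_pM2r ?invr_gt0//.
    by apply: ge0_ler_powR; rewrite ?nnegrE//; exact: ltW.
rewrite /kgamma -/(kgamma_fun k x) /Rintegral fine_le ?integrable_fin_num//.
- exact: integrableS fi.
- apply: ge0_subset_integral; [exact: measurable_itv|exact: measurable_itv|..|exact: s12].
  + by have /integrableP[] := fi.
  + by move=> t _; rewrite lee_fin mulr_ge0 ?powR_ge0 ?expR_ge0.
Qed.

Lemma cvg_kgamma (R : realType) (k x : R) : 0 < k -> 0 < x ->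
  \int[lebesgue_measure]_(t in `[n.+1%:R^-1, n.+1%:R]) kgamma_fun k x t @[n --> \oo]
  --> kgamma k x.
Proof.
move=> k0 x0; have fi := integrable_kgamma_fun k0 x0.
apply: fine_cvg; rewrite fineK; last exact: integrable_fin_num.
apply: (ge0_integral_exhaustion (exhaustion_gt0 R)) => t.
  by rewrite /= in_itv/= andbT; exact: continuous_kgamma_fun.
by move=> _; rewrite mulr_ge0 ?powR_ge0 ?expR_ge0.
Qed.

(** The derivative of [T(t) = t^x exp(-t^k/k)] is integrated over [[1/(n+1), n+1]]; the boundary
    terms vanish in the limit, by [T(t) <= t^x] at 0 and [T(t) <= K / t] at infinity. *)
Lemma kgammaD (R : realType) (k x : R) : 0 < k -> 0 < x ->
  kgamma k (x + k) = x * kgamma k x.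
Proof.
move=> k0 x0; have xk0 : 0 < x + k by exact: addr_gt0.
(* The exponent is [x + 1] because [t T(t) = t^(x+1) exp(-t^k/k)] is the quantity to bound. *)
have [K K0 KP] := powR_expRN_bounded k0 (addr_gt0 x0 ltr01).
pose T := kgamma_fun k (x + 1).
have T0 (t : R) : 0 <= T t by rewrite mulr_ge0 ?powR_ge0 ?expR_ge0.
have TE (t : R) : T t = t `^ x * expR (- (t `^ k / k)) by rewrite /T /kgamma_fun addrK.
have Tc : T n.+1%:R^-1 @[n --> \oo] --> (0 : R).
  have h : (n.+1%:R^-1 : R) `^ x @[n --> \oo] --> (0 : R).
    rewrite -(powR0 (lt0r_neq0 x0)) -rpow_powR//.
    under eq_fun do rewrite -rpow_powR//.
    apply: (@cvg_comp _ _ _ (fun n => n.+1%:R^-1 : R) (@rpow R ^~ x)).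
      exact: cvg_harmonic.
    by apply: continuous_rpow; right.
  apply: (squeeze_cvgr _ (cvg_cst 0) h); apply: nearW => n.
  rewrite T0 TE ler_piMr ?powR_ge0// -expR0 ler_expR oppr_le0.
  by rewrite divr_ge0 ?powR_ge0// ltW.
have Td : T n.+1%:R @[n --> \oo] --> (0 : R).
  have h : K * n.+1%:R^-1 @[n --> \oo] --> (0 : R).
    by rewrite -(mulr0 K); apply: cvgM; [exact: cvg_cst|exact: cvg_harmonic].
  apply: (squeeze_cvgr _ (cvg_cst 0) h); apply: nearW => n.
  rewrite T0/= ler_pdivlMr// (le_trans _ (KP n.+1%:R _))//.
  rewrite TE mulrAC ler_wpM2r ?expR_ge0//.
  have p0 := powR_ge0 (n.+1%:R : R) (x + 1).
  rewrite -{2}[n.+1%:R]powRr1// -powRD ?implybT//; last by rewrite pnatr_eq0 implybT.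
  have := sqr_ge0 ((n.+1%:R : R) `^ (x + 1)); nra.
apply/eqP; rewrite -subr_eq0; apply/eqP.
pose I y n := \int[lebesgue_measure]_(t in `[n.+1%:R^-1, n.+1%:R]) kgamma_fun k y t.
have c1 : I (x + k) n - x * I x n @[n --> \oo] --> kgamma k (x + k) - x * kgamma k x.
  apply: cvgB; first exact: cvg_kgamma.
  by apply: cvgM; [exact: cvg_cst|exact: cvg_kgamma].
have c2 : T n.+1%:R^-1 - T n.+1%:R @[n --> \oo] --> (0 : R).
  by rewrite -[X in _ --> X](subr0 0); apply: cvgB; [exact: Tc|exact: Td].
rewrite -(cvg_lim (@Rhausdorff R) c1); apply/cvg_lim => //; apply: cvg_trans c2.
apply: near_eq_cvg; apply: nearW => n /=.
have [_ _ cd _ _] := exhaustion_gt0 R.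
pose f t := x * kgamma_fun k x t - kgamma_fun k (x + k) t.
have pos (t : R) : n.+1%:R^-1 <= t <= n.+1%:R -> 0 < t.
  by move=> /andP[+ _]; apply: lt_le_trans; rewrite invr_gt0.
have cf (t y : R) : n.+1%:R^-1 <= t <= n.+1%:R -> {for t, continuous (kgamma_fun k y)}.
  by move=> /pos; exact: continuous_kgamma_fun.
have cf2 (t : R) : n.+1%:R^-1 <= t <= n.+1%:R -> {for t, continuous f}.
  move=> tn; apply: continuousB; last exact: cf.
  by apply: continuousM; [exact: cst_continuous|exact: cf].
have dT (t : R) : n.+1%:R^-1 <= t <= n.+1%:R -> is_derive t 1 T (f t).
  by move=> /pos; exact: is_derive_kgamma_fun.
have : \int[lebesgue_measure]_(t in `[n.+1%:R^-1, n.+1%:R])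
    (x * kgamma_fun k x t - kgamma_fun k (x + k) t) = T n.+1%:R - T n.+1%:R^-1.
  by rewrite /Rintegral (integral_is_derive (cd n) cf2 dT).
have i1 y : lebesgue_measure.-integrable `[n.+1%:R^-1, n.+1%:R] (EFin \o kgamma_fun k y).
  by apply: integrable_continuous_cc => t /cf.
rewrite RintegralB//; last exact: (integrableZl _ x (i1 x)).
by rewrite RintegralZl//= => h; rewrite -[RHS]opprB h opprB.
Qed.

(** * Mean value inequality, weighted trapezoid estimate, Hoelder's inequality *)

(** With [M] a primitive of the continuous bound [m], the difference [H - M] has a nonpositive
    derivative, hence is nonincreasing. *)
Lemma increment_le (R : realType) (H dH m : R -> R) (a b : R) : a < b ->
  (forall x : R, a <= x <= b -> {for x, continuous H}) ->
  (forall x : R, a <= x <= b -> {for x, continuous m}) ->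
  (forall x : R, a < x < b -> is_derive x 1 H (dH x)) ->
  (forall x : R, a < x < b -> dH x <= m x) ->
  H b - H a <= \int[lebesgue_measure]_(x in `[a, b]) m x.
Proof.
move=> ab cH cm dHE dHm.
have [M [cM dM ME]] := exists_primitive ab (integrable_continuous_cc cm).
have dHM (x : R) : a < x < b -> is_derive x 1 (fun y => H y - M y) (dH x - m x).
  move=> /[dup] xab /andP[ax xb]; apply: is_deriveB; first exact: dHE.
  by apply: dM => //; apply: cm; rewrite !ltW.
have := @ler0_derive1_nincr _ (fun y => H y - M y) a b.
move=> /(_ _ _ _ a b (lexx _) (ltW ab) (lexx _)) mono.
rewrite -ME; have : H b - M b <= H a - M a; last lra.
apply: mono.
- by move=> x; rewrite in_itv/= => /dHM[].
- move=> x; rewrite in_itv/= => xab.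
  by rewrite derive1E (@derive_val _ _ _ _ _ _ _ (dHM x xab)) subr_le0 dHm.
- by apply: continuous_on_cc => x xab; apply: continuousB; [exact: cH|exact: cM].
Qed.

Lemma norm_increment_le (R : realType) (H dH m : R -> R) (a b : R) : a < b ->
  (forall x : R, a <= x <= b -> {for x, continuous H}) ->
  (forall x : R, a <= x <= b -> {for x, continuous m}) ->
  (forall x : R, a < x < b -> is_derive x 1 H (dH x)) ->
  (forall x : R, a < x < b -> `|dH x| <= m x) ->
  `|H b - H a| <= \int[lebesgue_measure]_(x in `[a, b]) m x.
Proof.
move=> ab cH cm dHE dHm; rewrite ler_norml; apply/andP; split; last first.
  by apply: (increment_le ab cH cm dHE) => x /dHm; apply: le_trans; exact: ler_norm.
have dHN (x : R) : a < x < b -> is_derive x 1 (fun y => - H y) (- dH x).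
  by move=> /dHE ?; exact: is_deriveN.
rewrite lerNl opprB addrC -[H a]opprK.
apply: (increment_le ab _ cm dHN) => x /=.
  by move=> /cH; exact: continuousN.
by move=> /dHm; apply: le_trans; rewrite -normrN ler_norm.
Qed.

Lemma integrable_mul_continuous (R : realType) (f h : R -> R) (a b : R) :
  lebesgue_measure.-integrable `[a, b] (EFin \o f) ->
  (forall x : R, a <= x <= b -> {for x, continuous h}) ->
  lebesgue_measure.-integrable `[a, b] (EFin \o (fun x => f x * h x)).
Proof.
move=> fi ch; have hi := integrable_continuous_cc ch.
have -> : EFin \o (fun x => f x * h x) = ((EFin \o f) \* (EFin \o h))%E by [].
apply: integrableMl => //; first by have /integrableP[/measurable_EFinP] := hi.
have := continuous_compact (continuous_on_cc ch) (@segment_compact R a b).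
move=> /compact_bounded[M [Mr hM]]; exists M; split => // z /hM hz x xab.
by apply: hz; exists x.
Qed.

Lemma integrable_add_fun (R : realType) (f h : R -> R) (a b : R) :
  lebesgue_measure.-integrable `[a, b] (EFin \o f) ->
  lebesgue_measure.-integrable `[a, b] (EFin \o h) ->
  lebesgue_measure.-integrable `[a, b] (EFin \o (fun x => f x + h x)).
Proof.
move=> fi hi.
have -> : EFin \o (fun x => f x + h x) = ((EFin \o f) \+ (EFin \o h))%E by [].
exact: integrableD.
Qed.

Lemma integrable_mul_cst (R : realType) (f : R -> R) (a b c : R) :
  lebesgue_measure.-integrable `[a, b] (EFin \o f) ->
  lebesgue_measure.-integrable `[a, b] (EFin \o (fun x => c * f x)).
Proof.
move=> fi.
have -> : EFin \o (fun x => c * f x) = (fun x => c%:E * (EFin \o f) x)%E by [].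
exact: integrableZl.
Qed.

Lemma Rintegral_combination (R : realType) (f h G : R -> R) (a b c : R) :
  lebesgue_measure.-integrable `[a, b] (EFin \o f) ->
  lebesgue_measure.-integrable `[a, b] (EFin \o h) ->
  (forall x : R, a <= x <= b -> {for x, continuous G}) ->
  \int[lebesgue_measure]_(x in `[a, b]) (c * (f x + h x) * G x) =
  c * (\int[lebesgue_measure]_(x in `[a, b]) (f x * G x)
       + \int[lebesgue_measure]_(x in `[a, b]) (h x * G x)).
Proof.
move=> fi hi cG; have fGi := integrable_mul_continuous fi cG.
have hGi := integrable_mul_continuous hi cG.
rewrite -RintegralD// -RintegralZl//; last exact: integrable_add_fun.
by apply: eq_Rintegral => x _; rewrite -mulrDl mulrA.
Qed.

Lemma continuous_refl_sum (R : realType) (g : R -> R) (a b : R) :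
  (forall x : R, a <= x <= b -> derivable g x 1) ->
  forall x : R, a <= x <= b -> {for x, continuous (refl_sum g a b)}.
Proof.
move=> dg x xab; have cg (y : R) : a <= y <= b -> {for y, continuous g}.
  by move=> /dg /derivable1_diffP/differentiable_continuous.
apply: continuousD; first exact: cg.
apply: (@continuous_comp _ _ _ (fun y : R => a + b - y) g).
  by apply: continuousB; [exact: cst_continuous|exact: cvg_id].
by apply: cg; lra.
Qed.

Lemma convex_itv (R : realType) (a b t : R) : a <= b -> 0 <= t <= 1 ->
  (a <= t * a + (1 - t) * b <= b) && (a <= t * b + (1 - t) * a <= b).
Proof. by move=> ab /andP[t0 t1]; apply/andP; split; nra. Qed.

(** The analytic core, for an arbitrary weight [w = W']: the theorem is the case where [w] is the
    sum of the two kernels up to a constant. *)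
Lemma trapezoid_weighted_le (R : realType) (W w g m : R -> R) (a b : R) : a < b ->
  (forall x : R, a <= x <= b -> {for x, continuous W}) ->
  (forall x : R, a < x < b -> {for x, continuous w}) ->
  (forall x : R, a < x < b -> is_derive x 1 W (w x)) ->
  lebesgue_measure.-integrable `[a, b] (EFin \o w) ->
  (forall x : R, a <= x <= b -> derivable g x 1) ->
  (forall t : R, 0 <= t <= 1 -> {for t, continuous m}) ->
  (forall t : R, 0 < t < 1 ->
    `|(W (t * a + (1 - t) * b) - W (t * b + (1 - t) * a))
       * derive1 g (t * a + (1 - t) * b)| <= m t) ->
  `|(W b - W a) * (g a + g b)
     - \int[lebesgue_measure]_(x in `[a, b]) (w x * (g x + g (a + b - x)))|
  <= (b - a) * \int[lebesgue_measure]_(t in `[0, 1]) m t.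
Proof.
move=> ab cW cw dW wi dg cm mP.
pose u (t : R) := t * a + (1 - t) * b; pose v (t : R) := t * b + (1 - t) * a.
have cg (x : R) : a <= x <= b -> {for x, continuous g}.
  by move=> /dg /derivable1_diffP/differentiable_continuous.
have cgr (x : R) : a <= x <= b -> {for x, continuous (fun y : R => g (a + b - y))}.
  move=> xab; apply: (@continuous_comp _ _ _ (fun y => a + b - y) g).
    by apply: continuousB; [exact: cst_continuous|exact: cvg_id].
  by apply: cg; move: xab; lra.
have wgi := integrable_mul_continuous wi cg.
have wgri := integrable_mul_continuous wi cgr.
have [C [cC dC CE]] := exists_primitive ab wgi.
have [D [cD dD DE]] := exists_primitive ab wgri.
have du (t : R) : is_derive t 1 u (a - b).
  by apply: is_derive_eq; rewrite /GRing.scale/=; ring.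
have dv (t : R) : is_derive t 1 v (b - a).
  by apply: is_derive_eq; rewrite /GRing.scale/=; ring.
have uab (t : R) : 0 <= t <= 1 -> a <= u t <= b by move=> /andP[? ?]; rewrite /u; nra.
have vab (t : R) : 0 <= t <= 1 -> a <= v t <= b by move=> /andP[? ?]; rewrite /v; nra.
have uabo (t : R) : 0 < t < 1 -> a < u t < b by move=> /andP[? ?]; rewrite /u; nra.
have vabo (t : R) : 0 < t < 1 -> a < v t < b by move=> /andP[? ?]; rewrite /v; nra.
have cu (t : R) : {for t, continuous u} by exact: is_derive_continuous (du t).
have cv (t : R) : {for t, continuous v} by exact: is_derive_continuous (dv t).
pose H t := (W (u t) - W (v t)) * g (u t) - C (u t) + D (v t).
pose dH t := (a - b) * ((W (u t) - W (v t)) * derive1 g (u t)).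
have cH (t : R) : 0 <= t <= 1 -> {for t, continuous H}.
  move=> t01; have U := uab t t01; have V := vab t t01.
  have cUf (f : R -> R) : {for u t, continuous f} -> {for t, continuous (fun t : R => f (u t) : R)}.
    by move=> cf; apply: (@continuous_comp _ _ _ u f).
  have cVf (f : R -> R) : {for v t, continuous f} -> {for t, continuous (fun t : R => f (v t) : R)}.
    by move=> cf; apply: (@continuous_comp _ _ _ v f).
  apply: continuousD; last by apply: cVf; exact: cD.
  apply: continuousB; last by apply: cUf; exact: cC.
  apply: continuousM; last by apply: cUf; exact: cg.
  by apply: continuousB; [apply: cUf; exact: cW|apply: cVf; exact: cW].
have dHE (t : R) : 0 < t < 1 -> is_derive t 1 H (dH t).
  move=> t01; have U := uabo t t01; have V := vabo t t01.
  have U' : a <= u t <= b by case/andP: U => *; rewrite !ltW.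
  have V' : a <= v t <= b by case/andP: V => *; rewrite !ltW.
  have dUf (f : R -> R) d : is_derive (u t) 1 f d ->
      is_derive t 1 (fun t : R => f (u t) : R) (d * (a - b)).
    by move=> df; apply: (@is_derive1_comp _ f u).
  have dVf (f : R -> R) d : is_derive (v t) 1 f d ->
      is_derive t 1 (fun t : R => f (v t) : R) (d * (b - a)).
    by move=> df; apply: (@is_derive1_comp _ f v).
  have dgu : is_derive (u t) 1 g (derive1 g (u t)).
    by rewrite derive1E; apply: DeriveDef => //; exact: dg.
  have cCw : {for u t, continuous (fun x => w x * g x)}.
    by apply: continuousM; [exact: cw|exact: cg].
  have cDw : {for v t, continuous (fun x => w x * g (a + b - x))}.
    by apply: continuousM; [exact: cw|exact: cgr].
  have D1 := is_deriveB (dUf _ _ (dW _ U)) (dVf _ _ (dW _ V)).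
  have D2 := is_deriveM D1 (dUf _ _ dgu).
  have D3 := is_deriveB D2 (dUf _ _ (dC _ U cCw)).
  have D4 := is_deriveD D3 (dVf _ _ (dD _ V cDw)).
  apply: (is_derive_eq D4).
  (* The derivative of [D (v t)] thus carries [g (u t)], and all terms in [w] cancel. *)
  have -> : a + b - v t = u t by rewrite /u /v; ring.
  by rewrite /dH /GRing.scale/= !fctE; ring.
have := @norm_increment_le _ H dH (fun t : R => (b - a) * m t) 0 1 ltr01 cH _ dHE.
(* At [t = 1] the pair [(u, v)] is [(a, b)] and at [t = 0] it is [(b, a)]; the increments of [C] and
   [D] over [[a, b]] add up to the weighted integral. *)
have -> : H 1 - H 0 = - ((W b - W a) * (g a + g b) - ((C b - C a) + (D b - D a))).
  by rewrite /H /u /v !(mul1r, mul0r, subrr, subr0, addr0, add0r); ring.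
rewrite normrN CE DE -RintegralD//.
rewrite RintegralZl//; last exact: integrable_continuous_cc.
have -> : \int[lebesgue_measure]_(x in `[a, b]) (w x * g x + w x * g (a + b - x)) =
    \int[lebesgue_measure]_(x in `[a, b]) (w x * (g x + g (a + b - x))).
  by apply: eq_Rintegral => x _; rewrite mulrDr.
apply.
- by move=> t t01; apply: continuousM; [exact: cst_continuous|exact: cm].
- move=> t t01; rewrite /dH normrM distrC (@gtr0_norm _ (b - a)) ?subr_gt0//.
  by apply: ler_wpM2l; [rewrite subr_ge0 ltW|exact: mP].
Qed.

(** The second factor is given as a [1/q]-th power, so its [q]-norm only involves the integral of
    [|h|], which is explicit when [h] is affine. *)
Lemma hoelder_continuous (R : realType) (f h : R -> R) (a b p q : R) :
  0 < p -> 0 < q -> p^-1 + q^-1 = 1 ->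
  (forall x : R, a <= x <= b -> {for x, continuous f}) ->
  (forall x : R, a <= x <= b -> {for x, continuous h}) ->
  \int[lebesgue_measure]_(x in `[a, b]) (`|f x| * `|h x| `^ q^-1) <=
  (\int[lebesgue_measure]_(x in `[a, b]) (`|f x| `^ p)) `^ p^-1 *
  (\int[lebesgue_measure]_(x in `[a, b]) `|h x|) `^ q^-1.
Proof.
move=> p0 q0 pq cf ch.
have cn (k : R -> R) s : 0 < s -> (forall x : R, a <= x <= b -> {for x, continuous k}) ->
    forall x : R, a <= x <= b -> {for x, continuous (fun x : R => `|k x| `^ s)}.
  move=> s0 ck x xab; have -> : (fun x => `|k x| `^ s) = (fun x => `|rpow (k x) s|).
    by apply/funext => y; rewrite normr_rpow.
  apply: (@continuous_comp _ _ _ (fun x => rpow (k x) s) (@Num.norm R R));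
    last exact: norm_continuous.
  apply: (@continuous_comp _ _ _ k (@rpow R ^~ s)); first exact: ck.
  by apply: continuous_rpow; right.
have iq : 0 < q^-1 by rewrite invr_gt0.
(* Hoelder's inequality is stated on the whole line, hence the extensions by zero. *)
pose F : R -> R := f \_ `[a, b]; pose G : R -> R := (fun x => `|h x| `^ q^-1) \_ `[a, b].
have mpatch (k : R -> R) : (forall x : R, a <= x <= b -> {for x, continuous k}) ->
    measurable_fun [set: R] (k \_ `[a, b]).
  move=> ck; apply/(measurable_restrictT _ _).1 => //.
  by have /integrableP[/measurable_EFinP] := integrable_continuous_cc ck.
have mF := mpatch _ cf; have mG := mpatch _ (cn h _ iq ch).
have := @hoelder _ (measurableTypeR R) R (@lebesgue_measure R) F G p q mF mG p0 q0 pq.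
have i1 := integrable_continuous_cc (cn f _ p0 cf).
have i2 : lebesgue_measure.-integrable `[a, b] (EFin \o (fun x => `|h x|)).
  apply: integrable_continuous_cc => x xab.
  by apply: (@continuous_comp _ _ _ h (@Num.norm R R)); [exact: ch|exact: norm_continuous].
have i3 : lebesgue_measure.-integrable `[a, b] (EFin \o (fun x => `|f x| * `|h x| `^ q^-1)).
  apply: integrable_continuous_cc => x xab.
  apply: continuousM; last exact: cn.
  by apply: (@continuous_comp _ _ _ f (@Num.norm R R)); [exact: cf|exact: norm_continuous].
have E1 : ('N[lebesgue_measure]_1[EFin \o (F \* G)%R] =
    (\int[lebesgue_measure]_(x in `[a, b]) (`|f x| * `|h x| `^ q^-1))%:E)%E.
  rewrite Lnorm1 /Rintegral fineK; last exact: integrable_fin_num.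
  rewrite [RHS]integral_mkcond; apply: eq_integral => x _ /=.
  rewrite /F /G !patchE; case: ifP => _; last by rewrite mul0r normr0.
  by rewrite normrM [X in (_ * X)%:E]ger0_norm ?powR_ge0.
have E2 : ('N[lebesgue_measure]_(p%:E)[EFin \o F] =
    ((\int[lebesgue_measure]_(x in `[a, b]) (`|f x| `^ p)) `^ p^-1)%:E)%E.
  rewrite Lnorm.unlock -poweR_EFin /Rintegral fineK; last exact: integrable_fin_num.
  congr (_ `^ _)%E; rewrite [RHS]integral_mkcond; apply: eq_integral => x _ /=.
  rewrite /F !patchE; case: ifP => _//=.
  by rewrite normr0 powR0// gt_eqF.
have E3 : ('N[lebesgue_measure]_(q%:E)[EFin \o G] =
    ((\int[lebesgue_measure]_(x in `[a, b]) `|h x|) `^ q^-1)%:E)%E.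
  rewrite Lnorm.unlock -poweR_EFin /Rintegral fineK; last exact: integrable_fin_num.
  congr (_ `^ _)%E; rewrite [RHS]integral_mkcond; apply: eq_integral => x _ /=.
  rewrite /G !patchE; case: ifP => _/=; last by rewrite normr0 powR0// gt_eqF.
  by rewrite ger0_norm ?powR_ge0// -powRrM mulVf ?gt_eqF// powRr1.
by rewrite E1 E2 E3 -EFinM lee_fin.
Qed.

(** * Powers and kernels on the admissible domain *)

(** The condition [r / 2 \is a Num.int] says that [r] is an even integer, so that [x^r] is a
    square. *)
Lemma rpow_even_gt0 (R : realType) (r x : R) :
  0 < x \/ r / 2 \is a Num.int -> x != 0 -> 0 < rpow x r.
Proof.
move=> [x0 _|/intrP[z rE] x0]; first by rewrite rpow_powR ?powR_gt0// ltW.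
have {rE} -> : r = (z * 2)%:~R by rewrite intrM -rE divfK.
rewrite /rpow intr_int intrKfloor -exprz_exp.
by rewrite -[X in 0 < X]/((x ^ z) ^+ 2) exprn_even_gt0//= expfz_neq0.
Qed.

Lemma admissible_neq0 (R : realType) (a b r s t : R) : admissible a b r s -> a < t < b ->
  t != 0 \/ r \is a Num.nat.
Proof.
move=> [+ _ _] /andP[at_ tb]; case=> [a0|[a0 _]|[rZ [r0|b0]]].
- by left; rewrite gt_eqF// (lt_trans a0).
- by left; rewrite gt_eqF// (le_lt_trans a0).
- by right; rewrite -intrEge0.
- by left; rewrite lt_eqF// (lt_trans tb).
Qed.

Lemma continuous_rpowD1 (R : realType) (a b r s t : R) : admissible a b r s -> a <= t <= b ->
  {for t, continuous (@rpow R ^~ (r + 1))}.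
Proof.
move=> [+ _ _] /andP[at_ tb] => h; apply: continuous_rpow.
case: h => [a0|[_ r1]|[rZ [r0|b0]]].
- by left; rewrite gt_eqF// (lt_le_trans a0).
- by right; lra.
- by right; lra.
- by left; rewrite lt_eqF// (le_lt_trans tb).
Qed.

Lemma is_derive_rpowD1 (R : realType) (a b r s t : R) : admissible a b r s -> a < t < b ->
  is_derive t 1 (@rpow R ^~ (r + 1)) ((r + 1) * rpow t r).
Proof.
move=> adm tab; have h := admissible_neq0 adm tab.
have -> : (r + 1) * rpow t r = (r + 1) * rpow t (r + 1 - 1) * rsg (r + 1) t.
  (* For an integer [r] this sign is 1 by definition; otherwise admissibility forces
     [0 <= a < t]. *)
  rewrite addrK; suff -> : rsg (r + 1) t = 1 by rewrite mulr1.
  have [rZ|t0] : r \is a Num.int \/ 0 < t.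
    case: adm tab => + _ _ /andP[at_ tb].
    case=> [a0|[a0 _]|[rZ _]]; [right|right|by left].
      exact: lt_trans at_.
    exact: le_lt_trans at_.
    by rewrite /rsg rpredD// int_num1.
  exact: rsg_gt0.
apply: is_derive_rpow; case: h => [t0|rN]; [by left|right].
by rewrite rpredD ?int_num1 ?intr_nat ?ltr_wpDl ?natr_ge0.
Qed.

Lemma continuous_rpow_admissible (R : realType) (a b r s t : R) : admissible a b r s -> a < t < b ->
  {for t, continuous (@rpow R ^~ r)}.
Proof.
move=> adm /(admissible_neq0 adm)[t0|]; last exact: continuous_rpow_natr.
by apply: continuous_rpow; left.
Qed.

Lemma rpowD1_incr (R : realType) (a b r s x y : R) : admissible a b r s -> r != -1 ->
  0 <= a \/ r / 2 \is a Num.int -> a <= x -> x < y -> y <= b ->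
  0 < (rpow y (r + 1) - rpow x (r + 1)) * (r + 1).
Proof.
move=> adm r1 mono ax xy yb.
have r10 : r + 1 != 0 by rewrite -(subr_eq0 _ (- 1)) opprK in r1.
have incr (x' y' : R) : a <= x' -> x' < y' -> y' <= b -> (0 <= x') || (y' <= 0) ->
    0 < (rpow y' (r + 1) - rpow x' (r + 1)) * (r + 1).
  move=> ax' xy' yb' nz.
  have dphi z : z \in `]x', y'[ -> is_derive z 1 (@rpow R ^~ (r + 1)) ((r + 1) * rpow z r).
    by rewrite in_itv/= => /andP[? ?]; apply: (is_derive_rpowD1 adm); lra.
  have [|c] := MVT xy' dphi.
    by apply: continuous_on_cc => z /andP[? ?]; apply: (continuous_rpowD1 adm); lra.
  rewrite in_itv/= => /andP[xc cy] ->.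
  have c0 : c != 0.
    case/orP: nz => nz; first by rewrite gt_eqF// (le_lt_trans nz).
    by rewrite lt_eqF// (lt_le_trans cy).
  have rc0 : 0 < rpow c r.
    by apply: rpow_even_gt0 => //; case: mono => [a0|]; [left; lra|right].
  rewrite (_ : _ * _ = (r + 1) ^+ 2 * (rpow c r * (y' - x'))); last by ring.
  apply: mulr_gt0; first by rewrite exprn_even_gt0.
  by apply: mulr_gt0; rewrite ?subr_gt0.
(* A segment with 0 in its interior is cut there: the mean value point must be nonzero for
   [rpow c r] to be positive. *)
have [x0|x0] := leP 0 x; first by apply: incr => //; rewrite x0.
have [y0|y0] := leP y 0; first by apply: incr => //; rewrite y0 orbT.
have i1 : 0 < (rpow 0 (r + 1) - rpow x (r + 1)) * (r + 1).
  by apply: incr; rewrite ?lexx ?orbT//; lra.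
have i2 : 0 < (rpow y (r + 1) - rpow 0 (r + 1)) * (r + 1).
  by apply: incr; rewrite ?lexx ?orbT//; lra.
lra.
Qed.

(** Serves both kernels: [D = phi - phi a] with [e = 1], and [D = phi b - phi] with [e = -1]. *)
Lemma kernel_admissible (R : realType) (a b r s e : R) (D : R -> R) :
  admissible a b r s -> r != -1 ->
  a < b -> 0 < s -> e != 0 ->
  (forall t : R, a <= t <= b -> {for t, continuous D}) ->
  (forall t : R, a < t < b -> is_derive t 1 D (e * ((r + 1) * rpow t r))) ->
  (0 <= a \/ r / 2 \is a Num.int -> forall t : R, a < t < b -> 0 < D t * (r + 1)) ->
  let w (t : R) := rpow (D t) (s - 1) * rpow t r in
  [/\ forall t : R, a <= t <= b -> {for t, continuous (fun t : R => rpow (D t) s)},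
      forall t : R, a < t < b -> {for t, continuous w},
      forall t : R, a < t < b ->
        is_derive t 1 (fun t : R => rpow (D t) s) (e * (s * (r + 1) * rsg s (r + 1)) * w t)
    & lebesgue_measure.-integrable `[a, b] (EFin \o w)].
Proof.
move=> adm r1 ab s0 e0 cD dD posD w.
have r10 : r + 1 != 0 by rewrite -(subr_eq0 _ (- 1)) opprK in r1.
have cP (t : R) : a <= t <= b -> {for t, continuous (fun t : R => rpow (D t) s)}.
  move=> tab; apply: (@continuous_comp _ _ _ D (@rpow R ^~ s)); first exact: cD.
  by apply: continuous_rpow; right.
have s1N : s \is a Num.int -> s - 1 \is a Num.nat.
  move=> sZ; have /natrP[[|n] sE] : s \is a Num.nat by rewrite -intrEge0// ltW.
    by rewrite sE ltxx in s0.
  by rewrite sE -natr1 addrK natr_nat.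
have split : (0 <= a \/ r / 2 \is a Num.int) \/ (a < 0 /\ s \is a Num.int).
  have [a0|a0] := leP 0 a; first by left; left.
  by have [_ + _] := adm; case=> [|sZ|rZ]; [lra|right|left; right].
(* Either [D t * (r + 1) > 0], so both factors have the same sign, or [s] is an integer and both
   values of [rsg] are 1. *)
have signD (t : R) : a < t < b ->
    (D t != 0 \/ (s \is a Num.int /\ 0 < s)) /\ rsg s (D t) = rsg s (r + 1).
  move=> tab; case: split => [/posD/(_ _ tab) Dt|[_ sZ]]; last first.
    by rewrite /rsg sZ; split; [right|].
  have Dt0 : D t != 0 by apply: contraTneq Dt => ->; rewrite mul0r ltxx.
  split; first by left.
  have := rsg_gt0 s Dt; rewrite rsgM /rsg; case: ifP => // _.
  by move=> /(congr1 (fun z => z * Num.sg (r + 1))); rewrite -mulrA -expr2 sqr_sg r10 mulr1 mul1r.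
have cw (t : R) : a < t < b -> {for t, continuous w}.
  move=> tab; have tab' : a <= t <= b by case/andP: tab => *; rewrite !ltW.
  apply: continuousM; last exact: (continuous_rpow_admissible adm).
  apply: (@continuous_comp _ _ _ D (@rpow R ^~ (s - 1))); first exact: cD.
  have [[Dt0|[sZ _]] _] := signD t tab; last exact/continuous_rpow_natr/s1N.
  by apply: continuous_rpow; left.
have dP (t : R) : a < t < b ->
    is_derive t 1 (fun t : R => rpow (D t) s) (e * (s * (r + 1) * rsg s (r + 1)) * w t).
  move=> tab; have [h sE] := signD t tab.
  have dr := is_derive_rpow h; rewrite sE in dr.
  have dc := @is_derive1_comp _ (@rpow R ^~ s) D t _ _ dr (dD t tab).
  by apply: (is_derive_eq dc); rewrite /w; ring.
(* If [a < 0] and [s] is an integer, the kernel may change sign, but [s - 1] is then natural and the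
   kernel is continuous on [[a, b]]. *)
split=> //; case: split => [mono|[a0 sZ]]; last first.
  apply: integrable_continuous_cc => t tab; apply: continuousM.
    apply: (@continuous_comp _ _ _ D (@rpow R ^~ (s - 1))); first exact: cD.
    exact/continuous_rpow_natr/s1N.
  have [+ _ _] := adm; case=> [|[]|[rZ [rge0|b0]]]; [lra|lra|..].
    by apply: continuous_rpow_natr; rewrite -intrEge0.
  by apply: continuous_rpow; left; case/andP: tab => _ tb; rewrite lt_eqF// (le_lt_trans tb).
(* This factor changes the base [D t] into [D t * (r + 1) > 0], which makes [k0 * w] nonnegative. *)
pose k0 := rpow (r + 1) (s - 1).
have k00 : k0 != 0 by exact: rpow_neq0.
pose kap := e * (s * (r + 1) * rsg s (r + 1)).
have kap0 : kap != 0.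
  rewrite !mulf_neq0 ?(gt_eqF s0)// /rsg; case: ifP => _; rewrite ?oner_eq0//.
  by rewrite sgr_eq0.
have fi : lebesgue_measure.-integrable `[a, b] (EFin \o (fun t => k0 * w t)).
  apply: (@ge0_integrable_is_derive _ _ (fun t => k0 / kap * rpow (D t) s)) => //.
  - by move=> t tab; apply: continuousM; [exact: cst_continuous|exact: cP].
  - by move=> t tab; apply: continuousM; [exact: cst_continuous|exact: cw].
  - move=> t tab; rewrite /w mulrA /k0 -rpowM mulrC mulr_ge0//.
      have [->|t0] := eqVneq t 0; last first.
        by apply/ltW/rpow_even_gt0 => //; case: mono => [a0|]; [left; lra|right].
      exact: rpow_ge0.
    by apply: rpow_ge0; rewrite mulrC; apply/ltW/posD.
  - move=> t tab; have dt := dP t tab.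
    apply: (is_derive_eq (is_deriveZ (k0 / kap) dt)); rewrite /GRing.scale/= -/kap.
    by rewrite mulrA divfK.
have -> : EFin \o w = (fun t => k0^-1%:E * (EFin \o (fun t => k0 * w t)%R) t)%E.
  by apply/funext => t /=; rewrite -EFinM mulKf.
exact: integrableZl.
Qed.

(** * Constants of the fractional integrals and conclusion *)

Lemma norm_div_le (R : realType) (c N P J A B : R) : 0 <= c -> P != 0 ->
  `|N| <= c * J -> J <= A * B -> `|N / (4 * P)| <= c / (4 * `|P|) * B * A.
Proof.
move=> c0 P0 NJ JAB; have nP0 : 0 < 4 * `|P| by rewrite mulr_gt0// normr_gt0.
have -> : `|N / (4 * P)| = `|N| / (4 * `|P|) by rewrite normrM normfV normrM (@ger0_norm _ 4).
rewrite ler_pdivrMr// (le_trans NJ)//.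
have -> : c / (4 * `|P|) * B * A * (4 * `|P|) = c * (A * B).
  by field; rewrite normr_eq0.
exact: ler_wpM2l.
Qed.

Lemma interior_itv (R : realType) (I : set R) (a b x : R) :
  is_interval I -> I° a -> I° b -> a <= x <= b -> I° x.
Proof.
move=> itvI Ia Ib /andP[]; rewrite le_eqVlt => /predU1P[<- //|ax].
rewrite le_eqVlt => /predU1P[-> //|xb].
have sub : `]a, b[%classic `<=` I.
  move=> y /=; rewrite in_itv/= => /andP[/ltW ay /ltW yb].
  by apply: (itvI a b) => //; [exact: interior_subset Ia|exact: interior_subset Ib|rewrite ay].
move: sub; rewrite open_subsetE; last exact: interval_open.
by apply; rewrite /= in_itv/= ax.
Qed.

Lemma Rintegral_affine01 (R : realType) (c d : R) :
  \int[lebesgue_measure]_(t in `[0, 1]) (c + t * d) = c + d / 2.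
Proof.
have cf (t : R) : 0 <= t <= 1 -> {for t, continuous (fun t : R => c + t * d)}.
  move=> _; apply: continuousD; first exact: cst_continuous.
  by apply: continuousM; [exact: cvg_id|exact: cst_continuous].
have dF (t : R) : 0 <= t <= 1 ->
    is_derive t 1 (fun t : R => t * c + (t * t) * (d / 2)) (c + t * d).
  by move=> _; apply: is_derive_eq; rewrite /GRing.scale/=; field.
by rewrite /Rintegral (integral_is_derive ler01 cf dF)/=; ring.
Qed.

(** The recurrence leaves [alpha / k] once [Γ_k(α)], nonzero by positivity, is cancelled; the powers
    of [r + 1] leave [r + 1] up to [rsg]. The result is exactly the constant in the derivative of
    [W]. *)
Lemma krRL_sumE (R : realType) (k r alpha a b : R) (h : R -> R) :
  0 < alpha -> 0 < k -> r != -1 ->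
  rpow (r + 1) (alpha / k) * kgamma k (alpha + k)
    * (krRL_left k r alpha a h b + krRL_right k r alpha b h a)
  = alpha / k * (r + 1) * rsg (alpha / k) (r + 1) *
    (\int[lebesgue_measure]_(t in `[a, b])
       (rpow (rpow b (r + 1) - rpow t (r + 1)) (alpha / k - 1) * rpow t r * h t)
     + \int[lebesgue_measure]_(t in `[a, b])
       (rpow (rpow t (r + 1) - rpow a (r + 1)) (alpha / k - 1) * rpow t r * h t)).
Proof.
move=> a0 k0 r1.
have r10 : r + 1 != 0 by rewrite -(subr_eq0 _ (- 1)) opprK in r1.
have E (A B G J : R) : G != 0 -> A * (alpha * G) * (B / (k * G) * J) = alpha / k * (A * B) * J.
  by move=> G0; field; rewrite G0 gt_eqF.
rewrite /krRL_left /krRL_right -mulrDr kgammaD// E ?gt_eqF ?kgamma_gt0//.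
by rewrite rpow_mul_conj// [rsg _ _ * _]mulrC mulrA.
Qed.

(* MathComp-Analysis *)
Theorem theorem14 (R : realType) (alpha k r : R) (I : set R) (g : R -> R)
    (a b p q : R) (eta : R -> R -> R) :
  0 < alpha -> 0 < k -> r != -1 ->
  is_interval I ->
  (forall x, I° x -> derivable g x 1) ->
  I° a -> I° b -> a < b ->
  admissible a b r (alpha / k) ->
  g \_ `[a, b] \in Lfun lebesgue_measure +oo%E ->
  1 < q -> p^-1 + q^-1 = 1 ->
  eta_convex eta `[a, b] (dpow g q) ->
  [bounded eta z.1 z.2 |
    z in (dpow g q @` `[a, b]) `*` (dpow g q @` `[a, b])] ->
  `| (g a + g b) / 2
     - rpow (r + 1) (alpha / k) * kgamma k (alpha + k)
         / (4 * rpow (rpow b (r + 1) - rpow a (r + 1)) (alpha / k))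
       * (krRL_left k r alpha a (refl_sum g a b) b
          + krRL_right k r alpha b (refl_sum g a b) a) |
  <= (b - a) / (4 * `| rpow (rpow b (r + 1) - rpow a (r + 1)) (alpha / k) |)
     * (dpow g q b + eta (dpow g q a) (dpow g q b) / 2) `^ q^-1
     * norm01 p (Theta k r alpha a b).
Proof.
move=> alpha0 k0 r1 itvI dg Ia Ib ab adm _ q1 pq etaP _.
set s := alpha / k in adm *; have s0 : 0 < s by exact: divr_gt0.
pose phi (t : R) := rpow t (r + 1).
have q0 : 0 < q by exact: lt_trans q1.
have p0 : 0 < p.
  rewrite -invr_gt0 (_ : p^-1 = 1 - q^-1); last by rewrite -pq addrK.
  by rewrite subr_gt0 invf_lt1.
have dg' (x : R) : a <= x <= b -> derivable g x 1 by move=> xab; apply/dg/(interior_itv itvI Ia Ib).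
have cphi (t : R) : a <= t <= b -> {for t, continuous phi} by exact: continuous_rpowD1 adm.
have dphi (t : R) : a < t < b -> is_derive t 1 phi ((r + 1) * rpow t r).
  exact: is_derive_rpowD1 adm.
have cA (t : R) : a <= t <= b -> {for t, continuous (fun t : R => phi t - phi a)}.
  by move=> tab; apply: continuousB; [exact: cphi|exact: cst_continuous].
have cB (t : R) : a <= t <= b -> {for t, continuous (fun t : R => phi b - phi t)}.
  by move=> tab; apply: continuousB; [exact: cst_continuous|exact: cphi].
have dA (t : R) : a < t < b ->
    is_derive t 1 (fun t : R => phi t - phi a) (1 * ((r + 1) * rpow t r)).
  move=> /dphi dt; apply: (is_derive_eq (is_deriveB dt (is_derive_cst (phi a) t 1))).
  by rewrite mul1r subr0.
have dB (t : R) : a < t < b ->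
    is_derive t 1 (fun t : R => phi b - phi t) (-1 * ((r + 1) * rpow t r)).
  move=> /dphi dt; apply: (is_derive_eq (is_deriveB (is_derive_cst (phi b) t 1) dt)).
  by rewrite mulN1r sub0r.
have pA : 0 <= a \/ r / 2 \is a Num.int -> forall t : R, a < t < b -> 0 < (phi t - phi a) * (r + 1).
  by move=> mono t /andP[at_ tb]; apply: (rpowD1_incr adm r1 mono); rewrite // ltW.
have pB : 0 <= a \/ r / 2 \is a Num.int -> forall t : R, a < t < b -> 0 < (phi b - phi t) * (r + 1).
  by move=> mono t /andP[at_ tb]; apply: (rpowD1_incr adm r1 mono); rewrite // ltW.
have N10 : -1 != 0 :> R by rewrite oppr_eq0 oner_eq0.
have [cPA cwA dPA iA] := kernel_admissible adm r1 ab s0 (oner_neq0 R) cA dA pA.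
have [cPB cwB dPB iB] := kernel_admissible adm r1 ab s0 N10 cB dB pB.
pose kap := s * (r + 1) * rsg s (r + 1).
pose wA (t : R) := rpow (phi t - phi a) (s - 1) * rpow t r.
pose wB (t : R) := rpow (phi b - phi t) (s - 1) * rpow t r.
pose W (t : R) := rpow (phi t - phi a) s - rpow (phi b - phi t) s.
pose w (t : R) := kap * (wB t + wA t).
have cW (t : R) : a <= t <= b -> {for t, continuous W}.
  by move=> tab; apply: continuousB; [exact: cPA|exact: cPB].
have cw (t : R) : a < t < b -> {for t, continuous w}.
  move=> tab; apply: continuousM; first exact: cst_continuous.
  by apply: continuousD; [exact: cwB|exact: cwA].
have dW (t : R) : a < t < b -> is_derive t 1 W (w t).
  move=> tab; apply: (is_derive_eq (is_deriveB (dPA t tab) (dPB t tab))).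
  have E (x y z : R) : 1 * x * y - -1 * x * z = x * (z + y) by ring.
  exact: E.
have wBAi : lebesgue_measure.-integrable `[a, b] (EFin \o (fun t : R => wB t + wA t)).
  exact: integrable_add_fun iB iA.
have wi : lebesgue_measure.-integrable `[a, b] (EFin \o w).
  exact: integrable_mul_cst.
set X := dpow g q b; set Y := eta _ _.
(* Written in the shape to which Hoelder's inequality applies; the absolute value around [X + t * Y]
   is redundant on [[0, 1]]. *)
pose m (t : R) := `|Theta k r alpha a b t| * `|X + t * Y| `^ q^-1.
have ThetaE (t : R) : Theta k r alpha a b t = W (t * a + (1 - t) * b) - W (t * b + (1 - t) * a).
  have E (x y z c : R) : x - y + z - c = (x - c) - (y - z) by ring.
  exact: E.
have cTheta (t : R) : 0 <= t <= 1 -> {for t, continuous (Theta k r alpha a b)}.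
  move=> /(convex_itv (ltW ab))/andP[uab vab].
  have -> : Theta k r alpha a b = (fun t : R => W (t * a + (1 - t) * b) - W (t * b + (1 - t) * a)).
    by apply/funext => z.
  have cl (c d : R) : {for t, continuous (fun t : R => t * c + (1 - t) * d)}.
    apply: continuousD; apply: continuousM; try exact: cst_continuous; first exact: cvg_id.
    by apply: continuousB; [exact: cst_continuous|exact: cvg_id].
  apply: continuousB.
    by apply: (@continuous_comp _ _ _ (fun t : R => t * a + (1 - t) * b) W) => //; exact: cW.
  by apply: (@continuous_comp _ _ _ (fun t : R => t * b + (1 - t) * a) W) => //; exact: cW.
have cXY (t : R) : 0 <= t <= 1 -> {for t, continuous (fun t : R => X + t * Y)}.
  move=> _; apply: continuousD; first exact: cst_continuous.
  by apply: continuousM; [exact: cvg_id|exact: cst_continuous].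
(* Eta-convexity between [a] and [b] with [beta = t]; since the left side is nonnegative, so is
   [X + t * Y]. *)
have XYP (t : R) : 0 <= t <= 1 -> dpow g q (t * a + (1 - t) * b) <= X + t * Y.
  by move=> t01; apply: etaP => //=; rewrite in_itv/= lexx ltW.
have XY0 (t : R) : 0 <= t <= 1 -> 0 <= X + t * Y.
  by move=> /XYP; apply: le_trans; exact: powR_ge0.
have cm (t : R) : 0 <= t <= 1 -> {for t, continuous m}.
  move=> t01; apply: continuousM.
    by apply: (@continuous_comp _ _ _ _ (@Num.norm R R)); [exact: cTheta|exact: norm_continuous].
  have -> : (fun t : R => `|X + t * Y| `^ q^-1) = (fun t : R => `|rpow (X + t * Y) q^-1|).
    by apply/funext => z; rewrite normr_rpow.
  apply: (@continuous_comp _ _ _ (fun t : R => rpow (X + t * Y) q^-1) (@Num.norm R R));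
    last exact: norm_continuous.
  apply: (@continuous_comp _ _ _ _ (@rpow R ^~ q^-1)); first exact: cXY.
  by apply: continuous_rpow; right; rewrite invr_gt0.
have mP (t : R) : 0 < t < 1 ->
    `|(W (t * a + (1 - t) * b) - W (t * b + (1 - t) * a))
       * derive1 g (t * a + (1 - t) * b)| <= m t.
  move=> /andP[/ltW t0 /ltW t1]; have t01 : 0 <= t <= 1 by rewrite t0.
  rewrite -ThetaE normrM /m ler_wpM2l// (ger0_norm (XY0 t t01)).
  have E (z : R) : 0 <= z -> z = (z `^ q) `^ q^-1.
    by move=> z0; rewrite -powRrM mulfV ?gt_eqF// powRr1.
  rewrite [leLHS]E//.
  apply: ge0_ler_powR; rewrite ?nnegrE ?powR_ge0 ?XY0 ?invr_ge0 ?(ltW q0)//.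
  exact: XYP.
have main := trapezoid_weighted_le ab cW cw dW wi dg' cm mP.
have hol := hoelder_continuous p0 q0 pq cTheta cXY.
have IXY : \int[lebesgue_measure]_(t in `[0, 1]) `|X + t * Y| = X + Y / 2.
  rewrite -Rintegral_affine01; apply: eq_Rintegral => t.
  by rewrite inE/= in_itv/= => /XY0 /ger0_norm.
pose Phi := rpow (phi b - phi a) s.
have Phi0 : Phi != 0 by apply: rpow_neq0; case: adm => _ _; rewrite subr_eq0.
(* One term of [W] vanishes at each end because [0 < s]. This 2 and the 2 of the mean
   [(g a + g b) / 2] make up the denominator [4 * Phi]. *)
have WE : W b - W a = 2 * Phi.
  have -> : W b = Phi by rewrite /W (subrr (phi b)) rpow0// subr0.
  have -> : W a = - Phi by rewrite /W (subrr (phi a)) rpow0// sub0r.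
  by rewrite opprK mulr_natl mulr2n.
pose G := refl_sum g a b.
have cG : forall x : R, a <= x <= b -> {for x, continuous G}.
  exact: continuous_refl_sum.
have IwG : \int[lebesgue_measure]_(x in `[a, b]) (w x * (g x + g (a + b - x))) =
    kap * (\int[lebesgue_measure]_(x in `[a, b]) (wB x * G x)
         + \int[lebesgue_measure]_(x in `[a, b]) (wA x * G x)).
  exact: (Rintegral_combination kap iB iA cG).
have LE : (g a + g b) / 2 - rpow (r + 1) s * kgamma k (alpha + k) / (4 * Phi)
       * (krRL_left k r alpha a G b + krRL_right k r alpha b G a) =
   ((W b - W a) * (g a + g b)
     - \int[lebesgue_measure]_(x in `[a, b]) (w x * (g x + g (a + b - x)))) / (4 * Phi).
  have E (A K J L : R) : A * K * J = L ->
      (g a + g b) / 2 - A * K / (4 * Phi) * J = (2 * Phi * (g a + g b) - L) / (4 * Phi).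
    by move=> <-; field.
  by rewrite (E _ _ _ _ (krRL_sumE a b G alpha0 k0 r1)) IwG WE.
rewrite IXY in hol; have ba0 : 0 <= b - a by rewrite subr_ge0 ltW.
have := norm_div_le ba0 Phi0 main hol; rewrite -LE; exact.
Qed.
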